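(* There are no universal dictionaries in finite-dimensional Hilbert spaces: if $H$ is a finite-dimensional Hilbert space, then no dictionary $D$ in $H$ is universal.
   Context: Let $H$ be a Hilbert space (real or complex) with norm $|\cdot|$. A dictionary in $H$ is a subset $D$ of the unit sphere of $H$ with $\overline{\mathrm{span}}\,D=H$. For $m\in\mathbb{N}=\{1,2,\dots\}$, $\Sigma_m(D)=\{\sum_{k=1}^m\lambda_kg_k:\ \lambda_k\text{ scalars},\ g_k\in D\}$, $\sigma_m(x)=\mathrm{dist}(x,\Sigma_m(D))$ for $x\in H$, and $\sigma_0(x)=|x|$. A dictionary $D$ in $H$ is called universal if for every strictly decreasing real sequence $\alpha_0>\alpha_1>\dots$ with $\alpha_m\to0$ there exists $x\in H$ with $\sigma_m(x)=\alpha_m$ for all $m=0,1,2,\dots$ *)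

(* Defs.v *)
From HB Require Import structures.
From mathcomp Require Import all_boot all_order all_algebra.
From mathcomp Require Import complex.
From mathcomp Require Import all_classical all_reals all_analysis.

Set Implicit Arguments.
Unset Strict Implicit.
Unset Printing Implicit Defensive.

Import Order.TTheory GRing.Theory Num.Theory.
Import numFieldNormedType.Exports.

Local Open Scope classical_set_scope.
Local Open Scope ring_scope.

(* A Hilbert space over K: complete for the norm of an inner product that is
   linear in the first and theta-linear in the second argument.  Real Hilbert
   spaces are obtained for theta := idfun, complex ones for theta := conjC. *)
Record hilbertSpace (K : numFieldType) (theta : K -> K) := HilbertSpace {
  hilbert_carrier :> completeNormedModType K;
  hilbert_inner : {dot hilbert_carrier for theta};
  hilbert_normE : forall x : hilbert_carrier,
    `|x| ^+ 2 = hilbert_inner x x }.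

Definition finite_dimensional (K : numFieldType) (H : lmodType K) : Prop :=
  exists (n : nat) (f : {linear H -> 'rV[K]_n}), bijective f.

(* Sigma_set D m is the set of combinations of m elements of D, repetitions and
   zero coefficients being allowed; Sigma_set D 0 = [set 0]. *)
Definition Sigma_set (K : numFieldType) (H : lmodType K) (D : set H) (m : nat) :
    set H :=
  [set x | exists (lambda : 'I_m -> K) (g : 'I_m -> H),
     (forall k, D (g k)) /\ x = \sum_(k < m) lambda k *: g k].

Definition linear_span (K : numFieldType) (H : lmodType K) (D : set H) : set H :=
  \bigcup_m Sigma_set D m.

Definition dictionary (K : numFieldType) (H : normedModType K) (D : set H) :
    Prop :=
  D `<=` [set g | `|g| = 1] /\ closure (linear_span D) = [set: H].

Section approximation.
Context (R : realType) (K : numFieldType) (H : normedModType K).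

(* The library norm of H takes its values in the scalar field K; re : K -> R
   reads them as real numbers (idfun if K is R, the real part if K is R[i]). *)
Variable re : K -> R.

(* Meaningful for A nonempty only: the infimum of the empty set is 0.  For a
   dictionary, Sigma_set D m is empty only if m > 0 and D is empty, in which
   case H is the zero space. *)
Definition dist_set (x : H) (A : set H) : R := inf [set re `|x - y| | y in A].

Definition sigma (D : set H) (m : nat) (x : H) : R :=
  if m is 0 then re `|x| else dist_set x (Sigma_set D m).

Definition universal (D : set H) : Prop :=
  forall alpha : nat -> R,
    (forall m, alpha m.+1 < alpha m) -> alpha @ \oo --> (0 : R) ->
    exists x : H, forall m, sigma D m x = alpha m.

End approximation.

(* Main.v *)
Require Import Defs.
From HB Require Import structures.
From mathcomp Require Import all_boot all_order all_algebra.
From mathcomp Require Import complex.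
From mathcomp Require Import all_classical all_reals all_analysis.
Import Order.TTheory GRing.Theory Num.Theory.
Import numFieldNormedType.Exports.
Local Open Scope classical_set_scope.
Local Open Scope ring_scope.
Local Open Scope complex_scope.

(** In a space that embeds linearly into ['rV_n], every combination of elements
of [D] can be rewritten with at most [n] of them: a maximal linearly independent
subfamily spans the same space ([linear_span_sub_Sigma]).  So, for [D]
nonempty, [Sigma_set D n.+1] already contains [linear_span D], which is dense,
and the error [sigma D n.+1] vanishes identically ([sigma_eq0]).  A strictly decreasing null sequence is
positive at every index, hence is not the error sequence of any vector; the
sequence used below is [1 / (m + 1)].

The index [n.+1] rather than [n] is chosen because [sigma D 0] is the norm and
not a distance to a set, which matters when [n = 0].  The real and complex cases
differ only in how norms are read as real numbers, through [re], and in how real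
precisions are sent back to the scalar field, through [iota]. *)

Lemma Sigma_setS (K : numFieldType) (H : lmodType K) (D : set H) (m : nat) :
  D !=set0 -> Sigma_set D m `<=` Sigma_set D m.+1.
Proof.
move=> [d Dd] _ [lambda [g [Dg ->]]].
exists (fun i => oapp lambda 0 (unlift ord0 i)).
exists (fun i => oapp g d (unlift ord0 i)); split.
  by move=> i; case: (unlift ord0 i) => [j|] /=.
rewrite big_ord_recl unlift_none /= scale0r add0r.
by apply: eq_bigr => k _; rewrite liftK.
Qed.

Lemma Sigma_set_le (K : numFieldType) (H : lmodType K) (D : set H)
    (p q : nat) :
  D !=set0 -> (p <= q)%N -> Sigma_set D p `<=` Sigma_set D q.
Proof.
move=> D0 /subnK <-; elim: (q - p)%N => [//|k IHk] x /IHk.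
by rewrite addSn; apply: Sigma_setS.
Qed.

(** Row [k] of the matrix [G] below is the coordinate vector of [g k].  Rank many
rows of [G] generate its row space, and the rank is at most the number [n] of
columns. *)
Lemma linear_span_sub_Sigma (K : numFieldType) (H : lmodType K) (n : nat)
    (f : {linear H -> 'rV[K]_n}) (D : set H) :
  injective f -> D !=set0 -> linear_span D `<=` Sigma_set D n.
Proof.
move=> f_inj D0 _ [M _ [lambda [g [Dg ->]]]].
pose G := \matrix_(k < M) f (g k).
apply: (@Sigma_set_le _ _ _ (\rank G)) => //; first exact: rank_leq_col.
have /submxP[mu fxE] :
    (f (\sum_k lambda k *: g k)%R <= rowsub (maxrankfun G) G)%MS.
  rewrite eq_maxrowsub linear_sum summx_sub// => k _.
  by rewrite linearZ scalemx_sub// -[f (g k)](rowK (fun k => f (g k)) k) row_sub.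
exists (fun k => mu 0 k), (fun k => g (maxrankfun G k)); split=> [k //|].
apply: f_inj; rewrite fxE mulmx_sum_row linear_sum.
by apply: eq_bigr => k _; rewrite linearZ row_rowsub rowK.
Qed.

(** Balls of [H] have their radii in the scalar field [K]: [iota] turns a real
precision [e] into a radius small enough for [re] to read norms below [e]. *)
Lemma dist_set_eq0 (R : realType) (K : numFieldType) (H : normedModType K)
    (re : K -> R) (iota : R -> K) (A : set H) (x : H) :
  (forall z, 0 <= z -> 0 <= re z) ->
  (forall e, 0 < e -> 0 < iota e) ->
  (forall z e, z < iota e -> re z < e) ->
  closure A x -> dist_set re x A = 0.
Proof.
move=> re_ge0 iota_gt0 re_lt Ax.
have near_x e : 0 < e -> exists2 y, A y & re `|x - y| < e.
  move=> /iota_gt0 e0.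
  have [y [Ay]] := Ax _ (nbhsx_ballx x _ e0).
  by rewrite -ball_normE => xy; exists y => //; exact: re_lt.
have lb0 : lbound [set re `|x - y| | y in A] 0.
  by move=> _ [y _ <-]; exact: re_ge0.
apply/eqP; rewrite eq_le; apply/andP; split; last first.
  apply: lb_le_inf => //.
  by have [y Ay _] := near_x 1 ltr01; exists (re `|x - y|), y.
apply/ler_addgt0Pl => e /near_x[y Ay xy]; rewrite addr0.
by apply: le_trans (ltW xy); apply: ge_inf; [exists 0|exists y].
Qed.

Lemma sigma_eq0 (R : realType) (K : numFieldType) (H : normedModType K)
    (re : K -> R) (iota : R -> K) (n : nat) (f : {linear H -> 'rV[K]_n})
    (D : set H) (x : H) :
  (forall z, 0 <= z -> 0 <= re z) ->
  (forall e, 0 < e -> 0 < iota e) ->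
  (forall z e, z < iota e -> re z < e) ->
  injective f -> dictionary D -> sigma re D n.+1 x = 0.
Proof.
move=> re_ge0 iota_gt0 re_lt f_inj [_ spanD]; rewrite /sigma.
have [D0|/set0P D0] := eqVneq D set0.
  (* [Sigma_set set0 n.+1] is empty, and the infimum of the empty set is 0. *)
  rewrite /dist_set (_ : Sigma_set D n.+1 = set0) ?image_set0 ?inf0//.
  by apply/seteqP; split=> // y [_ [g [Dg _]]]; have := Dg ord0; rewrite D0.
apply: (@dist_set_eq0 _ _ _ _ iota) => //.
have : closure (linear_span D) x by rewrite spanD.
by apply: closure_subset => y /(@linear_span_sub_Sigma _ _ _ f _ f_inj D0); apply: Sigma_setS.
Qed.

Lemma not_universal (R : realType) (K : numFieldType) (H : normedModType K)
    (re : K -> R) (iota : R -> K) (D : set H) :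
  (forall z, 0 <= z -> 0 <= re z) ->
  (forall e, 0 < e -> 0 < iota e) ->
  (forall z e, z < iota e -> re z < e) ->
  finite_dimensional H -> dictionary D -> ~ universal re D.
Proof.
move=> re_ge0 iota_gt0 re_lt [n [f /bij_inj f_inj]] dictD univD.
have [|x /(_ n.+1)] := univD (@harmonic R) _ (@cvg_harmonic R).
  by move=> m; rewrite /harmonic /= ltf_pV2 ?posrE ?ltr0Sn// ltr_nat.
rewrite (@sigma_eq0 _ _ _ _ iota n f)// => /esym/eqP.
by rewrite gt_eqF// harmonic_gt0.
Qed.

Theorem mainTheorem6 (R : realType) :
  (forall (H : hilbertSpace (idfun : R -> R)), finite_dimensional H ->
     forall D : set H, dictionary D -> ~ universal (idfun : R -> R) D) /\
  (forall (H : hilbertSpace (Num.conj : R[i] -> R[i])), finite_dimensional H ->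
     forall D : set H, dictionary D -> ~ universal (@complex.Re R) D).
Proof.
split=> H finH D dictD.
  exact: (@not_universal _ _ _ idfun idfun).
apply: (@not_universal _ _ _ _ (real_complex R)) => //.
- by move=> z; rewrite lecE => /andP[].
- by move=> e e0; rewrite ltcR.
- by move=> z e; rewrite ltcE => /andP[].
Qed.
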